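(* The families $(\ell_r)_{r\ge1}$ and $(e^{\ell_r})_{r\ge1}$ of functions in $\mathcal{H}(D_{<1})$ are $\mathbb{C}$-linearly free and free from the constant function $1$ (i.e. each of the two families, with the constant function $1$ adjoined, is $\mathbb{C}$-linearly independent).
   Context: $D_{<1}$ is the open unit disc of $\mathbb{C}$, $\mathcal{H}(D_{<1})$ its algebra of holomorphic functions, $\gamma$ is Euler's constant and $\zeta$ is the Riemann zeta function. For $|z|<1$, $$\ell_1(z)=\gamma z-\sum_{n\ge2}\zeta(n)\frac{(-z)^n}{n},\qquad \ell_r(z)=-\sum_{n\ge1}\zeta(nr)\frac{(-z^r)^n}{n}\quad(r\ge2).$$ *)

(* Defs.v *)
From Stdlib Require Import Reals List.
From Coquelicot Require Import Coquelicot.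

Local Open Scope C_scope.

(* [Series] is total but real-valued only, hence the componentwise sum. *)
Definition CSeries (a : nat -> C) : C :=
  (Series (fun n => Re (a n)), Series (fun n => Im (a n))).

Definition Cexp (z : C) : C :=
  ((exp (Re z) * cos (Im z))%R, (exp (Re z) * sin (Im z))%R).

Definition euler_gamma : R :=
  real (Lim_seq (fun n => (sum_n_m (fun k => / INR k) 1 n - ln (INR n))%R)).

(* The Riemann zeta function at the integers s >= 2; the term of index n of the
   series is 1 / (n + 1)^s. *)
Definition zeta (s : nat) : R := Series (fun n => (/ INR (n + 1) ^ s)%R).

Definition unit_disc (z : C) : Prop := (Cmod z < 1)%R.

Definition holomorphic_on (D : C -> Prop) (f : C -> C) : Prop :=
  forall z : C, D z -> ex_derive (K := C_AbsRing) (V := C_NormedModule) f z.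

(* The summation index is n - 2 for [ell_one] and n - 1 for [ell_ge2]. *)
Definition ell_one (z : C) : C :=
  RtoC euler_gamma * z
  - CSeries (fun n => RtoC (zeta (n + 2)) * (- z) ^ (n + 2) / RtoC (INR (n + 2))).

Definition ell_ge2 (r : nat) (z : C) : C :=
  - CSeries (fun n => RtoC (zeta ((n + 1) * r)) * (- (z ^ r)) ^ (n + 1)
                      / RtoC (INR (n + 1))).

Definition pos_index : Set := {r : nat | (1 <= r)%nat}.

Definition ell (r : pos_index) : C -> C :=
  match proj1_sig r with
  | 1%nat => ell_one
  | k => ell_ge2 k
  end.

Definition exp_ell (r : pos_index) (z : C) : C := Cexp (ell r z).

(* C-linear independence of a family of functions on D: two functions on D are
   equal when they agree at the points of D, whatever their values elsewhere. *)
Definition linearly_free_on (D : C -> Prop) (I : Type) (f : I -> C -> C) : Prop :=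
  forall (s : list I) (c : I -> C), NoDup s ->
    (forall z : C, D z ->
       fold_right Cplus (RtoC 0) (map (fun i => c i * f i z) s) = RtoC 0) ->
    forall i : I, In i s -> c i = RtoC 0.

Definition adjoin_one (I : Type) (f : I -> C -> C) (i : option I) : C -> C :=
  match i with
  | Some j => f j
  | None => fun _ => RtoC 1
  end.

(* Main.v *)
From Stdlib Require Import Reals List Wf_nat Lra Lia.
From Coquelicot Require Import Coquelicot.
Require Import Defs.
Local Open Scope C_scope.

(** The point z = 0 decides everything. Each l_r factors on the disc as
    z^r h_r(z) with h_r holomorphic and h_r(0) <> 0: the lowest coefficient of
    l_r is the positive number zeta(r) for r >= 2, and gamma for r = 1
    ([ell_factor], [ell_quotient_0]). Since exp w = 1 + w q(w) with q continuous at
    0 and q(0) = 1, also exp(l_r) = 1 + z^r k_r(z), where k_r = h_r * (q o l_r) has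
    the same nonzero value at 0 as h_r. So, up to a constant, the members of either
    family vanish at 0 to the pairwise distinct orders r >= 1.

    Functions of this form are free together with 1 ([free_of_distinct_orders]):
    in a vanishing linear combination subtract the value at 0, let r be an index
    such that all coefficients of smaller index vanish, divide by z^r and let z
    tend to 0; what is left is c_r h_r(0) = 0. The coefficient of 1 is killed last,
    by evaluating at 0.

    Two analytic facts are used. A power series with bounded coefficients is
    holomorphic on the disc ([ex_Cderive_Cpow_series]), and so is the exponential;
    both follow from a bound of the first-order Taylor remainder by a multiple of
    |w - z|^2 ([is_derive_of_quadratic_remainder]). And gamma > 0
    ([euler_gamma_pos]), because H_n - ln n stays between 1 - ln 2 and 1. *)

(** * Complex derivatives and continuity *)

(** Differentiability with values in C as a module over itself, whose uniform
    structure is the one of the modulus. The product and chain rules live here,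
    while [holomorphic_on] uses on the values the uniform structure of the product
    R * R; both have the same norm, hence the same derivatives. *)
Notation C_self := (AbsRing_NormedModule C_AbsRing).
Notation ex_Cderive := (ex_derive (K := C_AbsRing) (V := C_self)).

Lemma is_derive_of_quadratic_remainder (f : C -> C) (z d : C) (M delta : R) :
  (0 < delta)%R ->
  (forall w, Cmod (w - z) < delta ->
     Cmod (f w - f z - d * (w - z)) <= M * Cmod (w - z) ^ 2)%R ->
  is_derive (K := C_AbsRing) (V := C_self) f z d.
Proof.
  intros Hd Hf; split.
  - apply (is_linear_scal_l (K := C_AbsRing) (V := C_self)).
  - intros x Hx; apply (is_filter_lim_locally_unique (V := C_self)) in Hx.
    intros eps.
    pose proof (cond_pos eps) as He.
    assert (HM : (0 < Rabs M + 1)%R) by (pose proof (Rabs_pos M); lra).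
    assert (Hr : (0 < Rmin delta (eps / (Rabs M + 1)))%R).
    { apply Rmin_pos; auto. apply Rdiv_lt_0_compat; auto. }
    exists (mkposreal _ Hr); intros w Hw.
    change (Cmod (w - z) < Rmin delta (eps / (Rabs M + 1)))%R in Hw.
    rewrite <- Hx.
    change (Cmod (f w - f z - (w - z) * d) <= eps * Cmod (w - z))%R.
    rewrite (Cmult_comm (w - z) d).
    pose proof (Rmin_l delta (eps / (Rabs M + 1))) as H1.
    pose proof (Rmin_r delta (eps / (Rabs M + 1))) as H2.
    eapply Rle_trans; [apply Hf; lra|].
    pose proof (Cmod_ge_0 (w - z)) as H0.
    pose proof (Rle_abs M) as HMa.
    assert (H3 : ((Rabs M + 1) * Cmod (w - z) <= eps)%R).
    { apply Rle_trans with ((Rabs M + 1) * (eps / (Rabs M + 1)))%R.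
      - apply Rmult_le_compat_l; lra.
      - right; field; lra. }
    replace (M * Cmod (w - z) ^ 2)%R with (M * Cmod (w - z) * Cmod (w - z))%R by ring.
    apply Rmult_le_compat_r; auto; nra.
Qed.

(** The remainder condition involves the norm of the values only, so that it is the
    same in both modules. *)
Lemma ex_derive_of_ex_Cderive (f : C -> C) (z : C) :
  ex_Cderive f z ->
  ex_derive (K := C_AbsRing) (V := C_NormedModule) f z.
Proof.
  intros [d [Hl Hd]]; exists d; split.
  - apply (is_linear_scal_l (K := C_AbsRing) (V := C_NormedModule)).
  - exact Hd.
Qed.

Lemma ex_Cderive_mult (f g : C -> C) (z : C) :
  ex_Cderive f z -> ex_Cderive g z -> ex_Cderive (fun x => f x * g x) z.
Proof.
  intros [df Hf] [dg Hg]; eexists.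
  apply (is_derive_mult (K := C_AbsRing) f g z df dg Hf Hg Cmult_comm).
Qed.

Lemma ex_Cderive_opp (f : C -> C) (z : C) :
  ex_Cderive f z -> ex_Cderive (fun x => - f x) z.
Proof. apply (ex_derive_opp (K := C_AbsRing) (V := C_self)). Qed.

Lemma ex_Cderive_comp (f g : C -> C) (z : C) :
  ex_Cderive f (g z) -> ex_Cderive g z -> ex_Cderive (fun x => f (g x)) z.
Proof. apply (ex_derive_comp (K := C_AbsRing) (V := C_self)). Qed.

Lemma ex_Cderive_pow (n : nat) (z : C) : ex_Cderive (fun x => x ^ n) z.
Proof.
  induction n as [|n IH].
  - exact (ex_derive_const (K := C_AbsRing) (V := C_self) (RtoC 1) z).
  - simpl; apply ex_Cderive_mult; auto.
    apply (ex_derive_id (K := C_AbsRing)).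
Qed.

Lemma unit_disc_0 : unit_disc 0.
Proof. unfold unit_disc; rewrite Cmod_0; lra. Qed.

Notation continuous_C :=
  (continuous (T := AbsRing_UniformSpace C_AbsRing) (U := AbsRing_UniformSpace C_AbsRing)).

Lemma continuous_C_const (c z : C) : continuous_C (fun _ => c) z.
Proof.
  exact (continuous_const (U := AbsRing_UniformSpace C_AbsRing)
    (V := AbsRing_UniformSpace C_AbsRing) c z).
Qed.

Lemma continuous_C_mult (f g : C -> C) (z : C) :
  continuous_C f z -> continuous_C g z -> continuous_C (fun x => f x * g x) z.
Proof.
  exact (continuous_mult (U := AbsRing_UniformSpace C_AbsRing) (K := C_AbsRing) f g z).
Qed.

Lemma continuous_C_comp (f g : C -> C) (z : C) :
  continuous_C f (g z) -> continuous_C g z -> continuous_C (fun x => f (g x)) z.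
Proof.
  intros Hf Hg.
  exact (continuous_comp (U := AbsRing_UniformSpace C_AbsRing)
    (V := AbsRing_UniformSpace C_AbsRing) (W := AbsRing_UniformSpace C_AbsRing) g f z Hg Hf).
Qed.

Lemma continuous_C_pow (n : nat) (z : C) : continuous_C (fun x => x ^ n) z.
Proof.
  apply (ex_derive_continuous (K := C_AbsRing) (V := C_self)), ex_Cderive_pow.
Qed.

Lemma continuous_eq_0 (g : C -> C) :
  continuous_C g (RtoC 0) -> (forall z, unit_disc z -> z <> 0 -> g z = 0) -> g 0 = 0.
Proof.
  intros Hg Hz; apply Cmod_eq_0.
  destruct (Rle_lt_or_eq_dec _ _ (Cmod_ge_0 (g 0))) as [Hpos|]; [exfalso|auto].
  destruct (proj1 (filterlim_locally (U := AbsRing_UniformSpace C_AbsRing) _ _) Hg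
    (mkposreal _ Hpos)) as [[d Hd] Hball].
  set (x := (Rmin d 1 / 2)%R).
  assert (Hx : (0 < x < d /\ x < 1)%R).
  { unfold x; pose proof (Rmin_l d 1); pose proof (Rmin_r d 1).
    pose proof (Rmin_pos d 1 Hd ltac:(lra)); lra. }
  specialize (Hball (RtoC x)).
  change (Cmod (RtoC x - 0) < d -> Cmod (g (RtoC x) - g 0) < Cmod (g 0))%R in Hball.
  rewrite (Hz (RtoC x)) in Hball.
  - replace (RtoC x - 0) with (RtoC x) in Hball by ring.
    replace (0 - g 0) with (- g 0) in Hball by ring.
    rewrite Cmod_opp, Cmod_R, Rabs_pos_eq in Hball by lra.
    specialize (Hball ltac:(lra)); lra.
  - unfold unit_disc; rewrite Cmod_R, Rabs_pos_eq; lra.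
  - intros E; apply RtoC_inj in E; lra.
Qed.

(** * Absolutely convergent complex series *)

Definition abs_summable (a : nat -> C) : Prop := ex_series (fun n => Cmod (a n)).

Lemma abs_summable_le (a : nat -> C) (b : nat -> R) :
  (forall n, Cmod (a n) <= b n)%R -> ex_series b -> abs_summable a.
Proof.
  intros Hab Hb; apply (ex_series_le (K := R_AbsRing) (V := R_CompleteNormedModule))
    with (2 := Hb).
  intros n; change (Rabs (Cmod (a n)) <= b n)%R.
  rewrite Rabs_pos_eq; auto using Cmod_ge_0.
Qed.

Lemma abs_summable_Re (a : nat -> C) :
  abs_summable a -> ex_series (fun n => Re (a n)).
Proof.
  intros Ha; apply (ex_series_le (K := R_AbsRing) (V := R_CompleteNormedModule))
    with (2 := Ha).
  intros n; apply re_le_Cmod.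
Qed.

Lemma im_le_Cmod (z : C) : (Rabs (Im z) <= Cmod z)%R.
Proof. eapply Rle_trans; [apply Rmax_r | apply Rmax_Cmod]. Qed.

Lemma abs_summable_Im (a : nat -> C) :
  abs_summable a -> ex_series (fun n => Im (a n)).
Proof.
  intros Ha; apply (ex_series_le (K := R_AbsRing) (V := R_CompleteNormedModule))
    with (2 := Ha).
  intros n; apply im_le_Cmod.
Qed.

Lemma Cmod_le_Re_Im (z : C) : (Cmod z <= Rabs (Re z) + Rabs (Im z))%R.
Proof.
  pose proof (Rabs_pos (Re z)); pose proof (Rabs_pos (Im z)).
  apply Rsqr_incr_0_var; [|lra].
  unfold Rsqr.
  replace (Cmod z * Cmod z)%R with (Cmod z ^ 2)%R by ring.
  rewrite Cmod2_alt, <- (pow2_abs (Re z)), <- (pow2_abs (Im z)); nra.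
Qed.

Lemma Series_abs_le (a b : nat -> R) :
  (forall n, Rabs (a n) <= b n)%R -> ex_series b ->
  (Rabs (Series a) <= Series b)%R.
Proof.
  intros Hab Hb.
  eapply Rle_trans; [apply Series_Rabs|].
  - apply (ex_series_le (K := R_AbsRing) (V := R_CompleteNormedModule)) with (2 := Hb).
    intros n; change (Rabs (Rabs (a n)) <= b n)%R; rewrite Rabs_Rabsolu; apply Hab.
  - apply Series_le; auto using Rabs_pos.
Qed.

(** Summing real and imaginary parts separately costs the factor 2, which is
    harmless for remainder estimates. *)
Lemma Cmod_CSeries_le (a : nat -> C) (b : nat -> R) :
  (forall n, Cmod (a n) <= b n)%R -> ex_series b ->
  (Cmod (CSeries a) <= 2 * Series b)%R.
Proof.
  intros Hab Hb.
  eapply Rle_trans; [apply Cmod_le_Re_Im|].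
  assert (Rabs (Series (fun n => Re (a n))) <= Series b)%R.
  { apply Series_abs_le; auto; intros n.
    eapply Rle_trans; [apply re_le_Cmod | apply Hab]. }
  assert (Rabs (Series (fun n => Im (a n))) <= Series b)%R.
  { apply Series_abs_le; auto; intros n.
    eapply Rle_trans; [apply im_le_Cmod | apply Hab]. }
  simpl; lra.
Qed.

Lemma CSeries_ext (a b : nat -> C) :
  (forall n, a n = b n) -> CSeries a = CSeries b.
Proof.
  intros Hab; unfold CSeries; f_equal; apply Series_ext; intros n; now rewrite Hab.
Qed.

Lemma abs_summable_lin (c : C) (a b : nat -> C) :
  abs_summable a -> abs_summable b -> abs_summable (fun n => a n + c * b n).
Proof.
  intros Ha Hb.
  apply abs_summable_le with (fun n => Cmod (a n) + Cmod c * Cmod (b n))%R.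
  - intros n; rewrite <- Cmod_mult; apply Cmod_triangle.
  - apply (ex_series_plus (K := R_AbsRing) (V := R_NormedModule)); auto.
    apply (ex_series_scal (K := R_AbsRing) (V := R_NormedModule)); auto.
Qed.

Lemma CSeries_lin (c : C) (a b : nat -> C) :
  abs_summable a -> abs_summable b ->
  CSeries (fun n => a n + c * b n) = CSeries a + c * CSeries b.
Proof.
  intros Ha Hb.
  pose proof (abs_summable_Re _ Ha); pose proof (abs_summable_Im _ Ha).
  pose proof (abs_summable_Re _ Hb); pose proof (abs_summable_Im _ Hb).
  assert (Hs : forall (k : R) (u : nat -> R), ex_series u -> ex_series (fun n => k * u n)%R).
  { intros k u; apply (ex_series_scal (K := R_AbsRing) (V := R_NormedModule)). }
  assert (Hm : forall (u v : nat -> R), ex_series u -> ex_series v ->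
    ex_series (fun n => u n - v n)%R).
  { intros u v; apply (ex_series_minus (K := R_AbsRing) (V := R_NormedModule)). }
  assert (Hp : forall (u v : nat -> R), ex_series u -> ex_series v ->
    ex_series (fun n => u n + v n)%R).
  { intros u v; apply (ex_series_plus (K := R_AbsRing) (V := R_NormedModule)). }
  apply injective_projections; simpl.
  - rewrite Series_plus, Series_minus, !Series_scal_l; auto.
  - rewrite !Series_plus, !Series_scal_l; auto.
Qed.

Lemma CSeries_scal (c : C) (a : nat -> C) :
  abs_summable a -> CSeries (fun n => c * a n) = c * CSeries a.
Proof.
  intros Ha.
  rewrite (CSeries_ext _ (fun n => a n + (c - 1) * a n)) by (intros; ring).
  rewrite CSeries_lin by assumption; ring.
Qed.

Lemma CSeries_incr_1 (a : nat -> C) :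
  abs_summable a -> CSeries a = a 0%nat + CSeries (fun n => a (S n)).
Proof.
  intros Ha; apply injective_projections; simpl.
  - rewrite Series_incr_1; auto using abs_summable_Re.
  - rewrite Series_incr_1; auto using abs_summable_Im.
Qed.

(** * Power series with bounded coefficients *)

Definition Cpow_series (a : nat -> R) (w : C) : C :=
  CSeries (fun n => RtoC (a n) * w ^ n).

(** Up to a constant this is dominated by the second derivative of the geometric
    series, and differentiation keeps the radius of convergence. *)
Lemma ex_series_square_geom (rho : R) :
  (0 <= rho < 1)%R -> ex_series (fun n => INR (S n) ^ 2 * rho ^ n)%R.
Proof.
  intros Hrho.
  set (a := PS_derive (PS_derive (fun _ => 1%R))).
  assert (Hcv : CV_radius a = 1%R).
  { unfold a; rewrite !CV_radius_derive, (CV_radius_finite_DAlembert _ 1%R);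
      [f_equal; field | intros; lra | lra |].
    apply is_lim_seq_ext with (fun _ => 1%R); [|apply is_lim_seq_const].
    intros n; rewrite Rdiv_1_r, Rabs_R1; reflexivity. }
  assert (H : ex_series (fun n => Rabs (a n * rho ^ n))).
  { apply CV_disk_inside; rewrite Hcv; simpl; rewrite Rabs_pos_eq; lra. }
  apply (ex_series_le (K := R_AbsRing) (V := R_CompleteNormedModule)) with (2 := H).
  intros n; change (Rabs (INR (S n) ^ 2 * rho ^ n) <= Rabs (a n * rho ^ n))%R.
  rewrite !Rabs_mult; apply Rmult_le_compat_r; [apply Rabs_pos|].
  unfold a, PS_derive.
  pose proof (pos_INR n); rewrite (S_INR (S n)), !S_INR.
  rewrite !Rabs_pos_eq; nra.
Qed.

(** Writing e_n for the Taylor remainder of w^n, one has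
    e_(n+1) = w' e_n + n w^(n-1) (w' - w)^2, and n^2 + n <= (n+1)^2. The factor
    rho^2 on the left avoids the exponent n - 2. *)
Lemma pow_remainder_bound (rho : R) (w w' : C) (n : nat) :
  (Cmod w <= rho -> Cmod w' <= rho ->
   rho ^ 2 * Cmod (w' ^ n - w ^ n - RtoC (INR n) * w ^ pred n * (w' - w))
    <= INR n ^ 2 * rho ^ n * Cmod (w' - w) ^ 2)%R.
Proof.
  intros Hw Hw'.
  pose proof (Cmod_ge_0 w) as H0.
  induction n as [|n IH].
  - replace (_ - _ - _) with (RtoC 0) by (simpl; ring).
    rewrite Cmod_0; simpl; lra.
  - replace (w' ^ S n - w ^ S n - RtoC (INR (S n)) * w ^ pred (S n) * (w' - w))
      with (w' * (w' ^ n - w ^ n - RtoC (INR n) * w ^ pred n * (w' - w))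
            + RtoC (INR n) * w ^ pred n * (w' - w) ^ 2).
    2:{ rewrite S_INR, RtoC_plus; destruct n as [|n]; simpl; ring. }
    set (e := w' ^ n - _ - _) in *.
    assert (Hlast : (rho ^ 2 * Cmod (RtoC (INR n) * w ^ pred n * (w' - w) ^ 2)
              <= INR n * rho ^ S n * Cmod (w' - w) ^ 2)%R).
    { rewrite !Cmod_mult, !Cmod_pow, Cmod_R, Rabs_pos_eq by apply pos_INR.
      rewrite <- !Rmult_assoc.
      apply Rmult_le_compat_r; [apply pow2_ge_0|].
      destruct n as [|n]; [simpl; lra|]; simpl pred.
      replace (INR (S n) * rho ^ S (S n))%R with (rho ^ 2 * INR (S n) * rho ^ n)%R
        by (simpl; ring).
      apply Rmult_le_compat_l.
      - apply Rmult_le_pos; [apply pow2_ge_0 | apply pos_INR].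
      - apply pow_incr; lra. }
    assert (Hfirst : (rho ^ 2 * Cmod (w' * e)
              <= rho * (INR n ^ 2 * rho ^ n * Cmod (w' - w) ^ 2))%R).
    { rewrite Cmod_mult.
      replace (rho ^ 2 * (Cmod w' * Cmod e))%R with (Cmod w' * (rho ^ 2 * Cmod e))%R by ring.
      apply Rmult_le_compat; auto using Cmod_ge_0.
      apply Rmult_le_pos; [apply pow2_ge_0 | apply Cmod_ge_0]. }
    pose proof (Cmod_triangle (w' * e) (RtoC (INR n) * w ^ pred n * (w' - w) ^ 2)) as Ht.
    apply Rmult_le_compat_l with (r := (rho ^ 2)%R) in Ht; [|apply pow2_ge_0].
    assert (Hpos : (0 <= rho ^ S n * Cmod (w' - w) ^ 2)%R).
    { apply Rmult_le_pos; [apply pow_le; lra | apply pow2_ge_0]. }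
    pose proof (pos_INR n).
    rewrite S_INR.
    replace ((INR n + 1) ^ 2 * rho ^ S n * Cmod (w' - w) ^ 2)%R with
      (rho * (INR n ^ 2 * rho ^ n * Cmod (w' - w) ^ 2)
        + INR n * rho ^ S n * Cmod (w' - w) ^ 2
        + (INR n + 1) * (rho ^ S n * Cmod (w' - w) ^ 2))%R by (simpl; ring).
    assert (0 <= (INR n + 1) * (rho ^ S n * Cmod (w' - w) ^ 2))%R
      by (apply Rmult_le_pos; lra).
    lra.
Qed.

Lemma Cpow_series_abs_summable (a : nat -> R) (M : R) (w : C) :
  (forall n, Rabs (a n) <= M)%R -> unit_disc w -> abs_summable (fun n => RtoC (a n) * w ^ n).
Proof.
  intros a_bounded Hw; pose proof (Cmod_ge_0 w).
  apply abs_summable_le with (fun n => M * Cmod w ^ n)%R.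
  - intros n; rewrite Cmod_mult, Cmod_pow, Cmod_R.
    apply Rmult_le_compat_r; auto; apply pow_le; auto.
  - apply (ex_series_scal (K := R_AbsRing) (V := R_NormedModule)).
    apply ex_series_geom; rewrite Rabs_pos_eq; auto.
Qed.

Lemma Cpow_series_0 (a : nat -> R) (M : R) :
  (forall n, Rabs (a n) <= M)%R -> Cpow_series a 0 = RtoC (a 0%nat).
Proof.
  intros a_bounded.
  pose proof (Cpow_series_abs_summable a M 0 a_bounded unit_disc_0) as Hs.
  unfold Cpow_series; rewrite CSeries_incr_1 by exact Hs.
  rewrite (CSeries_ext _ (fun n => 0 * (RtoC (a n) * 0 ^ n))) by (intros n; simpl; ring).
  rewrite CSeries_scal by exact Hs.
  simpl; ring.
Qed.

(** Near w all points have modulus at most rho, the midpoint of |w| and 1. Summing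
    [pow_remainder_bound] against the coefficients bounds the Taylor remainder of the
    sum by a convergent series times |w' - w|^2. *)
Lemma ex_Cderive_Cpow_series (a : nat -> R) (M : R) (w : C) :
  (forall n, Rabs (a n) <= M)%R -> unit_disc w ->
  ex_Cderive (Cpow_series a) w.
Proof.
  intros a_bounded Hw; unfold unit_disc in Hw; pose proof (Cmod_ge_0 w) as H0.
  set (rho := ((1 + Cmod w) / 2)%R).
  assert (Hrho : (1 / 2 <= rho < 1)%R) by (unfold rho; lra).
  assert (HM : (0 <= M)%R) by (eapply Rle_trans; [apply Rabs_pos | apply (a_bounded 0%nat)]).
  assert (Hsum : ex_series (fun n => INR (S n) ^ 2 * rho ^ n)%R)
    by (apply ex_series_square_geom; lra).
  (* [b] dominates both the derived series and the remainders; the 4 is an upper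
     bound for 1 / rho^2. *)
  set (b := (fun n => 4 * M * (INR (S n) ^ 2 * rho ^ n))%R).
  assert (Hb : ex_series b)
    by (apply (ex_series_scal (K := R_AbsRing) (V := R_NormedModule)); auto).
  set (a' := fun n => RtoC (INR n * a n) * w ^ pred n).
  assert (Ha' : abs_summable a').
  { apply abs_summable_le with (2 := Hb).
    intros n; unfold a', b.
    rewrite Cmod_mult, Cmod_pow, Cmod_R, Rabs_mult, (Rabs_pos_eq (INR n)) by apply pos_INR.
    destruct n as [|n].
    { simpl; lra. }
    simpl pred.
    assert (Hp : (0 <= Cmod w ^ n <= rho ^ n)%R).
    { split; [now apply pow_le | apply pow_incr; unfold rho; lra]. }
    assert (Hn : (1 <= INR (S n))%R) by (rewrite S_INR; pose proof (pos_INR n); lra).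
    rewrite (S_INR (S n)).
    apply Rle_trans with (INR (S n) * M * rho ^ n)%R.
    - apply Rmult_le_compat; try apply Hp.
      + apply Rmult_le_pos; [lra | apply Rabs_pos].
      + apply Rmult_le_compat_l; [lra | apply a_bounded].
    - replace (4 * M * ((INR (S n) + 1) ^ 2 * rho ^ S n))%R
        with (M * rho ^ n * (4 * rho * (INR (S n) + 1) ^ 2))%R by (simpl; ring).
      replace (INR (S n) * M * rho ^ n)%R with (M * rho ^ n * INR (S n))%R by ring.
      apply Rmult_le_compat_l; [apply Rmult_le_pos; lra|].
      nra. }
  exists (CSeries a').
  apply is_derive_of_quadratic_remainder with (M := (2 * Series b)%R)
    (delta := ((1 - Cmod w) / 2)%R); [lra|].
  intros w' Hw'.
  assert (Hw1 : (Cmod w' <= rho)%R).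
  { replace w' with (w + (w' - w)) by ring.
    eapply Rle_trans; [apply Cmod_triangle | unfold rho; lra]. }
  assert (Hdisc : unit_disc w') by (unfold unit_disc; lra).
  assert (E : Cpow_series a w' - Cpow_series a w - CSeries a' * (w' - w) =
    CSeries (fun n => RtoC (a n) *
      (w' ^ n - w ^ n - RtoC (INR n) * w ^ pred n * (w' - w)))).
  { pose proof (Cpow_series_abs_summable a M w a_bounded Hw) as S1.
    pose proof (Cpow_series_abs_summable a M w' a_bounded Hdisc) as S2.
    pose proof (abs_summable_lin (- (1)) _ _ S2 S1) as S3.
    rewrite (CSeries_ext (fun n => RtoC (a n) * _)
      (fun n => (RtoC (a n) * w' ^ n + - (1) * (RtoC (a n) * w ^ n)) + - (w' - w) * a' n))
      by (intros n; unfold a'; rewrite RtoC_mult; ring).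
    rewrite !CSeries_lin by assumption.
    unfold Cpow_series; ring. }
  rewrite E.
  replace (2 * Series b * Cmod (w' - w) ^ 2)%R
    with (2 * Series (fun n => Cmod (w' - w) ^ 2 * b n))%R by (rewrite Series_scal_l; ring).
  apply Cmod_CSeries_le.
  2: now apply (ex_series_scal (K := R_AbsRing) (V := R_NormedModule)).
  intros n; rewrite Cmod_mult, Cmod_R.
  pose proof (pow_remainder_bound rho w w' n ltac:(unfold rho; lra) Hw1) as Hr.
  set (e := Cmod (w' ^ n - _ - _)) in *.
  assert (He : (0 <= e)%R) by apply Cmod_ge_0.
  assert (Hpos : (0 <= rho ^ n * Cmod (w' - w) ^ 2)%R).
  { apply Rmult_le_pos; [apply pow_le; lra | apply pow2_ge_0]. }
  apply Rle_trans with (M * e)%R.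
  { apply Rmult_le_compat_r; auto. }
  unfold b.
  replace (Cmod (w' - w) ^ 2 * (4 * M * (INR (S n) ^ 2 * rho ^ n)))%R
    with (M * (4 * (INR (S n) ^ 2 * (rho ^ n * Cmod (w' - w) ^ 2))))%R by ring.
  apply Rmult_le_compat_l; auto.
  assert (Hsq : (INR n ^ 2 * (rho ^ n * Cmod (w' - w) ^ 2)
            <= INR (S n) ^ 2 * (rho ^ n * Cmod (w' - w) ^ 2))%R).
  { apply Rmult_le_compat_r; auto. apply pow_incr; rewrite S_INR.
    pose proof (pos_INR n); lra. }
  assert (Hq : (1 / 4 * e <= rho ^ 2 * e)%R) by (apply Rmult_le_compat_r; nra).
  lra.
Qed.

(** * The complex exponential *)

Lemma Cexp_plus (z w : C) : Cexp (z + w) = Cexp z * Cexp w.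
Proof.
  destruct z as [x y], w as [u v].
  apply injective_projections; simpl; rewrite exp_plus.
  - rewrite cos_plus; ring.
  - rewrite sin_plus; ring.
Qed.

(** The upper bound comes from [1 - x <= exp (- x) = 1 / exp x]. *)
Lemma exp_remainder_bound (x : R) :
  (Rabs x <= 1 / 2 -> Rabs (exp x - 1 - x) <= 2 * x ^ 2)%R.
Proof.
  intros Hx; apply Rabs_le_between in Hx.
  pose proof (exp_ineq1_le x) as H1; pose proof (exp_ineq1_le (- x)) as H2.
  assert (H3 : (exp x * exp (- x) = 1)%R)
    by (rewrite <- exp_plus, Rplus_opp_r; apply exp_0).
  pose proof (exp_pos x).
  rewrite Rabs_pos_eq; nra.
Qed.

(** For t >= 0, t - t^3/6 <= sin t <= t; the cosine follows by the half-angle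
    formula cos t - 1 = - 2 sin(t/2)^2, and negative arguments by parity. *)
Lemma sin_cos_remainder_bound (y : R) :
  (Rabs y <= 1 / 2 ->
   Rabs (sin y - y) <= y ^ 2 /\ Rabs (cos y - 1) <= y ^ 2)%R.
Proof.
  assert (Hpos : (forall t, 0 <= t <= 1 / 2 -> t - t ^ 3 / 6 <= sin t <= t)%R).
  { intros t Ht.
    destruct (pre_sin_bound t 0) as [H1 _]; try lra.
    unfold sin_approx, sin_term in H1; simpl in H1.
    split; [lra|].
    destruct (Req_dec t 0) as [->|Ht0]; [rewrite sin_0; lra|].
    left; apply sin_lt_x; lra. }
  assert (Hsin : (forall t, 0 <= t <= 1 / 2 ->
            Rabs (sin t - t) <= t ^ 2 /\ Rabs (cos t - 1) <= t ^ 2)%R).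
  { intros t Ht; pose proof (Hpos t Ht); pose proof (Hpos (t / 2) ltac:(lra))%R.
    split; [rewrite Rabs_left1; nra|].
    replace t with (2 * (t / 2))%R at 1 by field.
    rewrite cos_2a_sin.
    assert (0 <= sin (t / 2))%R by nra.
    rewrite Rabs_left1; nra. }
  intros Hy; destruct (Rle_dec 0 y) as [H|H].
  - apply Hsin; rewrite Rabs_pos_eq in Hy; lra.
  - rewrite Rabs_left in Hy by lra.
    destruct (Hsin (- y)%R ltac:(lra)) as [H1 H2].
    rewrite sin_neg in H1; rewrite cos_neg in H2.
    rewrite <- Rabs_Ropp in H1.
    replace (- (- sin y - - y))%R with (sin y - y)%R in H1 by ring.
    replace ((- y) ^ 2)%R with (y ^ 2)%R in * by ring; auto.
Qed.

(** With w = x + i y and e = exp x, the two components of the remainder are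
    e (cos y - 1) + (e - 1 - x) and e (sin y - y) + (e - 1) y. *)
Lemma Cexp_remainder_bound (w : C) :
  (Cmod w <= 1 / 2 -> Cmod (Cexp w - 1 - w) <= 8 * Cmod w ^ 2)%R.
Proof.
  intros Hw.
  pose proof (re_le_Cmod w) as Hx; pose proof (im_le_Cmod w) as Hy.
  rewrite Cmod2_alt.
  destruct w as [x y]; simpl Re in *; simpl Im in *.
  pose proof (exp_remainder_bound x ltac:(lra)) as Ee.
  destruct (sin_cos_remainder_bound y ltac:(lra)) as [Es Ec].
  eapply Rle_trans; [apply Cmod_le_Re_Im|]; simpl.
  assert (Hx' : (Rabs x <= 1/2)%R) by lra; assert (Hy' : (Rabs y <= 1/2)%R) by lra.
  clear Hx Hy Hw.
  apply Rabs_le_between in Hx', Hy', Ee, Es, Ec.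
  assert (exp x <= 2)%R by nra.
  pose proof (exp_pos x).
  set (u := (exp x)) in *; set (c := cos y) in *; set (s := sin y) in *.
  assert (Rabs (u * c + - (1) + - x) <= 2 * y ^ 2 + 2 * x ^ 2)%R.
  { replace (u * c + - (1) + - x)%R with (u * (c - 1) + (u - 1 - x))%R by ring.
    apply Rabs_le; nra. }
  assert (Rabs (u * s + - 0 + - y) <= 2 * y ^ 2 + (2 * x ^ 2 + 2 * y ^ 2))%R.
  { replace (u * s + - 0 + - y)%R with (u * (s - y) + (u - 1) * y)%R by ring.
    assert (- (2 * y ^ 2) <= u * (s - y) <= 2 * y ^ 2)%R by nra.
    assert (Hu : (-2 * Rabs x <= u - 1 <= 2 * Rabs x)%R)
      by (unfold Rabs; destruct (Rcase_abs x); nra).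
    assert (- (2 * x ^ 2 + 2 * y ^ 2) <= (u - 1) * y <= 2 * x ^ 2 + 2 * y ^ 2)%R.
    { rewrite <- (pow2_abs x). pose proof (Rabs_pos x); set (t := Rabs x) in *.
      pose proof (pow2_ge_0 (t - y)); pose proof (pow2_ge_0 (t + y)).
      destruct (Rle_dec 0 y); nra. }
    apply Rabs_le; lra. }
  nra.
Qed.

(** The addition formula moves the remainder bound at 0 to every point. *)
Lemma is_derive_Cexp (z : C) :
  is_derive (K := C_AbsRing) (V := C_self) Cexp z (Cexp z).
Proof.
  apply is_derive_of_quadratic_remainder with (M := (8 * Cmod (Cexp z))%R)
    (delta := (1 / 2)%R); [lra|].
  intros w Hw.
  replace (Cexp w - Cexp z - Cexp z * (w - z))
    with (Cexp z * (Cexp (w - z) - 1 - (w - z))).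
  2:{ replace w with (z + (w - z)) at 3 by ring. rewrite Cexp_plus; ring. }
  rewrite Cmod_mult.
  replace (8 * Cmod (Cexp z) * Cmod (w - z) ^ 2)%R
    with (Cmod (Cexp z) * (8 * Cmod (w - z) ^ 2))%R by ring.
  apply Rmult_le_compat_l; [apply Cmod_ge_0|].
  apply Cexp_remainder_bound; lra.
Qed.

(** The continuous extension of (exp w - 1) / w to w = 0. *)
Definition Cexp_quotient (w : C) : C :=
  if Ceq_dec w 0 then RtoC 1 else (Cexp w - 1) / w.

Lemma Cexp_0 : Cexp 0 = 1.
Proof.
  apply injective_projections; simpl; rewrite exp_0; [rewrite cos_0|rewrite sin_0]; ring.
Qed.

Lemma Cexp_factor (w : C) : Cexp w = 1 + w * Cexp_quotient w.
Proof.
  unfold Cexp_quotient; destruct (Ceq_dec w 0) as [->|Hw].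
  - rewrite Cexp_0; ring.
  - field; exact Hw.
Qed.

Lemma Cexp_quotient_0 : Cexp_quotient 0 = 1.
Proof. unfold Cexp_quotient; destruct (Ceq_dec 0 0); easy. Qed.

Lemma continuous_Cexp_quotient : continuous_C Cexp_quotient (RtoC 0).
Proof.
  apply (filterlim_locally (U := AbsRing_UniformSpace C_AbsRing)); intros eps.
  pose proof (cond_pos eps) as He.
  assert (Hd : (0 < Rmin (1 / 2) (eps / 16))%R) by (apply Rmin_pos; lra).
  exists (mkposreal _ Hd).
  change (forall w : C, Cmod (w - 0) < Rmin (1 / 2) (eps / 16) ->
    Cmod (Cexp_quotient w - Cexp_quotient 0) < eps)%R.
  intros w Hw.
  replace (w - 0) with w in Hw by ring.
  pose proof (Rmin_l (1 / 2) (eps / 16)); pose proof (Rmin_r (1 / 2) (eps / 16)).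
  rewrite Cexp_quotient_0.
  pose proof (Cexp_remainder_bound w ltac:(lra)) as Hr.
  rewrite Cexp_factor in Hr.
  replace (1 + w * Cexp_quotient w - 1 - w) with (w * (Cexp_quotient w - 1)) in Hr by ring.
  rewrite Cmod_mult in Hr.
  destruct (Ceq_dec w 0) as [->|Hw0].
  - rewrite Cexp_quotient_0; replace (1 - 1) with (RtoC 0) by ring; rewrite Cmod_0; lra.
  - apply Cmod_gt_0 in Hw0.
    apply Rle_lt_trans with (8 * Cmod w)%R; [|lra].
    apply Rmult_le_reg_l with (Cmod w); auto; nra.
Qed.

(** * Euler's constant and the zeta values *)

(** Both bounds are ln x <= x - 1, at x = (n+1)/n and at its inverse. *)
Lemma ln_succ_bounds (n : nat) :
  (1 <= n)%nat ->
  (/ INR (S n) <= ln (INR (S n)) - ln (INR n) <= / INR n)%R.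
Proof.
  intros Hn; apply le_INR in Hn; simpl in Hn.
  assert (Hln : (forall x, 0 < x -> ln x <= x - 1)%R).
  { intros x Hx; pose proof (exp_ineq1_le (ln x)) as H; rewrite exp_ln in H; lra. }
  rewrite S_INR, <- ln_div by lra.
  pose proof (Hln ((INR n + 1) / INR n)%R ltac:(apply Rdiv_lt_0_compat; lra)) as H1.
  pose proof (Hln (INR n / (INR n + 1))%R ltac:(apply Rdiv_lt_0_compat; lra)) as H2.
  rewrite ln_div in H1, H2 |- * by lra.
  replace ((INR n + 1) / INR n - 1)%R with (/ INR n)%R in H1 by (field; lra).
  replace (INR n / (INR n + 1) - 1)%R with (- / (INR n + 1))%R in H2 by (field; lra).
  lra.
Qed.

Lemma ln_2_lt_1 : (ln 2 < 1)%R.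
Proof.
  rewrite <- (ln_exp 1); apply ln_increasing; [lra|].
  pose proof (exp_ineq1 1 ltac:(lra)); lra.
Qed.

(** H_n - ln (n+1) increases from 1 - ln 2 and H_n - ln n decreases from 1; these
    bounds pass to the limit and make it finite and positive. *)
Lemma euler_gamma_pos : (0 < euler_gamma)%R.
Proof.
  set (u := fun n => (sum_n_m (fun k => / INR k) 1 n - ln (INR n))%R).
  assert (Hu : forall n, (1 - ln 2 + ln (INR (S (S n))) - ln (INR (S n)) <= u (S n) <= 1)%R).
  { induction n as [|n IH].
    - unfold u; rewrite sum_n_n; simpl INR; rewrite Rinv_1, ln_1.
      replace (1 + 1)%R with 2%R by ring; lra.
    - pose proof (ln_succ_bounds (S n) ltac:(lia)).
      pose proof (ln_succ_bounds (S (S n)) ltac:(lia)).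
      unfold u in *; rewrite sum_n_Sm by lia; change plus with Rplus; lra. }
  assert (Hb : forall n, (1 <= n)%nat -> (1 - ln 2 <= u n <= 1)%R).
  { intros [|n] Hn; [lia|]; pose proof (Hu n).
    pose proof (ln_succ_bounds (S n) Hn).
    assert (0 < / INR (S (S n)))%R by (apply Rinv_0_lt_compat, lt_0_INR; lia).
    lra. }
  pose proof ln_2_lt_1.
  assert (H1 : Rbar_le (1 - ln 2)%R (Lim_seq u)).
  { rewrite <- (Lim_seq_const (1 - ln 2)); apply Lim_seq_le_loc.
    exists 1%nat; intros; apply Hb; auto. }
  assert (H2 : Rbar_le (Lim_seq u) 1%R).
  { rewrite <- (Lim_seq_const 1); apply Lim_seq_le_loc.
    exists 1%nat; intros; apply Hb; auto. }
  unfold euler_gamma; fold u; destruct (Lim_seq u); simpl in *; try easy; lra.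
Qed.

(** Comparison with a telescoping series: 1 / (n+1)^2 <= 2 (1 / (n+1) - 1 / (n+2)). *)
Lemma ex_series_zeta_2 : ex_series (fun n => / INR (n + 1) ^ 2)%R.
Proof.
  assert (Ht : ex_series (fun n => / INR (n + 1) - / INR (n + 2))%R).
  { exists 1%R.
    change (is_lim_seq (sum_n (fun n => / INR (n + 1) - / INR (n + 2))%R) 1%R).
    apply (is_lim_seq_ext (fun n => 1 - / INR (n + 2))%R).
    - intros n; induction n as [|n IH].
      + rewrite sum_O; simpl; field.
      + rewrite sum_Sn, <- IH; change plus with Rplus.
        replace (S n + 1)%nat with (n + 2)%nat by lia; ring.
    - replace (Finite 1) with (Rbar_minus 1 (Rbar_inv p_infty)) by (simpl; f_equal; ring).
      apply is_lim_seq_minus'; [apply is_lim_seq_const|].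
      change 0%R with (real (Rbar_inv p_infty)).
      apply (is_lim_seq_inv (fun n => INR (n + 2)) p_infty); [|easy].
      apply -> (is_lim_seq_incr_n INR 2); apply is_lim_seq_INR. }
  apply (ex_series_scal (K := R_AbsRing) (V := R_NormedModule) 2%R) in Ht.
  apply (ex_series_le (K := R_AbsRing) (V := R_CompleteNormedModule)) with (2 := Ht).
  intros n; change (Rabs (/ INR (n + 1) ^ 2) <= 2 * (/ INR (n + 1) - / INR (n + 2)))%R.
  rewrite !plus_INR; simpl INR; pose proof (pos_INR n).
  assert (0 < (INR n + 1) ^ 2)%R by nra.
  rewrite Rabs_pos_eq by (left; now apply Rinv_0_lt_compat).
  replace (2 * (/ (INR n + 1) - / (INR n + (1 + 1))))%R
    with (/ ((INR n + 1) * (INR n + 2) / 2))%R by (field; lra).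
  apply Rinv_le_contravar; nra.
Qed.

Lemma zeta_term_le (s n : nat) :
  (2 <= s)%nat -> (0 <= / INR (n + 1) ^ s <= / INR (n + 1) ^ 2)%R.
Proof.
  intros Hs.
  assert (H1 : (1 <= INR (n + 1))%R) by (rewrite plus_INR; simpl; pose proof (pos_INR n); lra).
  split.
  - left; apply Rinv_0_lt_compat, pow_lt; lra.
  - apply Rinv_le_contravar; [apply pow_lt; lra | now apply Rle_pow].
Qed.

(** The lower bound is the first term of the series; the upper bound makes the
    coefficients of all l_r bounded. *)
Lemma zeta_bounds (s : nat) : (2 <= s)%nat -> (1 <= zeta s <= zeta 2)%R.
Proof.
  intros Hs.
  assert (Hex : ex_series (fun n => / INR (n + 1) ^ s)%R).
  { apply (ex_series_le (K := R_AbsRing) (V := R_CompleteNormedModule))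
      with (2 := ex_series_zeta_2).
    intros n; change (Rabs (/ INR (n + 1) ^ s) <= / INR (n + 1) ^ 2)%R.
    rewrite Rabs_pos_eq; now apply zeta_term_le. }
  unfold zeta; split.
  - rewrite Series_incr_1 by exact Hex.
    change (INR (0 + 1)) with 1%R; rewrite pow1, Rinv_1.
    enough (0 <= Series (fun n => / INR (S n + 1) ^ s))%R by lra.
    set (b := fun n => (/ INR (S n + 1) ^ s)%R).
    eapply Rle_trans; [apply Rabs_pos|].
    apply (Series_abs_le b b); unfold b.
    + intros n; rewrite Rabs_pos_eq; [lra | now apply zeta_term_le].
    + now apply -> (ex_series_incr_1 (K := R_AbsRing) (V := R_NormedModule)
        (fun n => (/ INR (n + 1) ^ s)%R)).
  - apply Series_le; [intros n; now apply zeta_term_le | apply ex_series_zeta_2].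
Qed.

(** * Functions of pairwise distinct orders at 0 *)

Lemma Cmult_eq_0_reg_l (x y : C) : x <> 0 -> x * y = 0 -> y = 0.
Proof.
  intros Hx E; replace y with (/ x * (x * y)) by (field; exact Hx).
  rewrite E; ring.
Qed.

Definition lsum {I : Type} (t : I -> C) (s : list I) : C := fold_right Cplus (RtoC 0) (map t s).

Lemma lsum_ext_in {I : Type} (t u : I -> C) (s : list I) :
  (forall i, In i s -> t i = u i) -> lsum t s = lsum u s.
Proof. intros H; unfold lsum; f_equal; now apply map_ext_in. Qed.

Lemma lsum_lin {I : Type} (t u : I -> C) (k : C) (s : list I) :
  lsum (fun i => t i + k * u i) s = lsum t s + k * lsum u s.
Proof.
  unfold lsum; induction s as [|i s IH]; simpl; [ring|]; rewrite IH; ring.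
Qed.

Lemma lsum_0 {I : Type} (t : I -> C) (s : list I) :
  (forall i, In i s -> t i = 0) -> lsum t s = 0.
Proof.
  intros H; induction s as [|i s IH]; [reflexivity|].
  unfold lsum in *; simpl; rewrite IH, (H i (in_eq i s)) by auto using in_cons; ring.
Qed.

Lemma lsum_single {I : Type} (t : I -> C) (s : list I) (i : I) :
  NoDup s -> In i s -> (forall j, In j s -> j <> i -> t j = 0) -> lsum t s = t i.
Proof.
  induction 1 as [|j s Hj Hs IH]; simpl; [easy|].
  intros [->|Hi] H; unfold lsum; simpl; fold (lsum t s).
  - rewrite lsum_0; [ring|]; intros k Hk; apply H; auto; now intros ->.
  - rewrite IH, (H j); auto; [ring|]; now intros ->.
Qed.

Lemma continuous_lsum {I : Type} (t : C -> I -> C) (s : list I) (z : C) :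
  (forall i, continuous_C (fun x => t x i) z) -> continuous_C (fun x => lsum (t x) s) z.
Proof.
  intros H; induction s as [|i s IH].
  - apply continuous_C_const.
  - apply (continuous_plus (K := C_AbsRing) (V := C_self) _ _ _ (H i) IH).
Qed.

Lemma pos_index_eq (r r' : pos_index) : proj1_sig r = proj1_sig r' -> r = r'.
Proof.
  destruct r as [r H], r' as [r' H']; simpl; intros ->; f_equal; apply Peano_dec.le_unique.
Qed.

(** Strong induction on the order n: once the coefficients of smaller index vanish,
    the combination minus its value at 0 is z^n G(z), where G is continuous at 0 and
    therefore zero there; all terms of G of order above n vanish at 0 as well. *)
Lemma free_of_distinct_orders (F : pos_index -> C -> C) (b : pos_index -> C)
    (h : pos_index -> C -> C) :
  (forall r z, unit_disc z -> F r z = b r + z ^ proj1_sig r * h r z) ->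
  (forall r, continuous_C (h r) (RtoC 0)) ->
  (forall r, h r 0 <> 0) ->
  linearly_free_on unit_disc (option pos_index) (adjoin_one pos_index F).
Proof.
  intros HF Hcont Hne s c Hnd Hrel.
  assert (Hsome : forall n (r : pos_index), proj1_sig r = n -> In (Some r) s -> c (Some r) = 0).
  { induction n as [n IH] using lt_wf_ind; intros r Hr Hin.
    (* The subtraction is truncated for indices below [n], whose coefficients are
       zero by induction. *)
    set (g := fun z i => match i with
      | Some j => c i * (z ^ (proj1_sig j - n) * h j z)
      | None => RtoC 0 end).
    assert (H0 : lsum (g 0) s = 0).
    { apply (continuous_eq_0 (fun z => lsum (g z) s)).
      - apply continuous_lsum; intros [j|]; simpl; [|apply continuous_C_const].
        apply continuous_C_mult; [apply continuous_C_const|].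
        apply continuous_C_mult; [|apply Hcont].
        apply continuous_C_pow.
      - intros z Hz Hz0.
        pose proof (Hrel z Hz) as E; fold (lsum (fun i => c i * adjoin_one pos_index F i z) s) in E.
        rewrite (lsum_ext_in _ (fun i => c i * adjoin_one pos_index F i 0 + z ^ n * g z i)) in E.
        + rewrite lsum_lin in E; unfold lsum at 1 in E.
          rewrite (Hrel 0 unit_disc_0), Cplus_0_l in E.
          apply Cmult_eq_0_reg_l in E; auto using Cpow_nz.
        + intros [j|] Hj; simpl; [|ring].
          rewrite !HF by auto using unit_disc_0.
          destruct (Nat.lt_ge_cases (proj1_sig j) n) as [Hlt|Hge].
          * rewrite (IH _ Hlt j eq_refl Hj); ring.
          * replace (z ^ proj1_sig j) with (z ^ n * z ^ (proj1_sig j - n))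
              by (rewrite <- Cpow_add_r; f_equal; lia).
            replace (0 ^ proj1_sig j) with (RtoC 0); [ring|].
            destruct j as [[|j] Hj1]; [lia|]; simpl; ring. }
    rewrite (lsum_single _ _ (Some r) Hnd Hin) in H0.
    - simpl in H0; rewrite Hr, Nat.sub_diag in H0; simpl in H0.
      rewrite Cmult_1_l, Cmult_comm in H0.
      now apply Cmult_eq_0_reg_l in H0.
    - intros [j|] Hj Hjr; simpl; auto.
      destruct (Nat.lt_trichotomy (proj1_sig j) n) as [Hlt|[Heq|Hgt]].
      + rewrite (IH _ Hlt j eq_refl Hj); ring.
      + exfalso; apply Hjr; f_equal; apply pos_index_eq; congruence.
      + replace (proj1_sig j - n)%nat with (S (proj1_sig j - n - 1)) by lia.
        simpl; ring. }
  intros [r|] Hin; [now apply (Hsome (proj1_sig r))|].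
  pose proof (Hrel 0 unit_disc_0) as E.
  fold (lsum (fun i => c i * adjoin_one pos_index F i 0) s) in E.
  rewrite (lsum_single _ _ None Hnd Hin) in E.
  - simpl in E; rewrite Cmult_1_r in E; exact E.
  - intros [j|] Hj Hn; [|easy]; rewrite (Hsome _ j eq_refl Hj); ring.
Qed.

(** * The functions l_r *)

(** With m = r, the coefficients of l_r, up to sign, as a power series in - z^r from
    which its first d powers have been taken out: d = 2 for r = 1, where the linear
    term is separate, and d = 1 for r >= 2. *)
Definition zeta_coef (d m n : nat) : R := (zeta ((n + d) * m) / INR (n + d))%R.

Lemma zeta_coef_bounded (d m n : nat) :
  (1 <= d)%nat -> (1 <= m)%nat -> (2 <= d * m)%nat -> (Rabs (zeta_coef d m n) <= zeta 2)%R.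
Proof.
  intros Hd Hm Hdm.
  assert (H1 : (1 <= INR (n + d))%R) by (apply (le_INR 1); lia).
  pose proof (zeta_bounds ((n + d) * m) ltac:(nia)) as Hz.
  unfold zeta_coef; rewrite Rabs_pos_eq.
  - apply Rmult_le_reg_r with (INR (n + d)); [lra|].
    unfold Rdiv; rewrite Rmult_assoc, Rinv_l, Rmult_1_r by lra; nra.
  - apply Rmult_le_pos; [lra | left; apply Rinv_0_lt_compat; lra].
Qed.

(** This is l_r(z) / z^r, with the singularity at 0 removed. *)
Definition ell_quotient (r : nat) (z : C) : C :=
  match r with
  | 1%nat => RtoC euler_gamma + - (z * Cpow_series (zeta_coef 2 1) (- z))
  | _ => Cpow_series (zeta_coef 1 r) (- z ^ r)
  end.

Lemma unit_disc_opp (z : C) : unit_disc z -> unit_disc (- z).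
Proof. unfold unit_disc; now rewrite Cmod_opp. Qed.

Lemma unit_disc_pow (r : nat) (z : C) : (1 <= r)%nat -> unit_disc z -> unit_disc (z ^ r).
Proof.
  unfold unit_disc; rewrite Cmod_pow; intros Hr Hz.
  apply pow_lt_1_compat; [split; auto using Cmod_ge_0 | lia].
Qed.

Lemma ell_factor (r : pos_index) (z : C) :
  unit_disc z -> ell r z = z ^ proj1_sig r * ell_quotient (proj1_sig r) z.
Proof.
  intros Hz; destruct r as [r Hr]; unfold ell; simpl.
  destruct r as [|[|r]]; [lia| |].
  - unfold ell_one, ell_quotient.
    rewrite (CSeries_ext _ (fun n => (- z) ^ 2 * (RtoC (zeta_coef 2 1 n) * (- z) ^ n))).
    + rewrite CSeries_scal.
      * unfold Cpow_series; simpl; ring.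
      * apply Cpow_series_abs_summable with (zeta 2); auto using unit_disc_opp.
        intros; apply zeta_coef_bounded; lia.
    + intros n; unfold zeta_coef.
      rewrite Nat.mul_1_r, RtoC_div, Cpow_add_r by (apply not_0_INR; lia).
      unfold Cdiv; ring.
  - unfold ell_ge2, ell_quotient; set (k := S (S r)) in *.
    rewrite (CSeries_ext _ (fun n => (- z ^ k) * (RtoC (zeta_coef 1 k n) * (- z ^ k) ^ n))).
    + rewrite CSeries_scal.
      * unfold Cpow_series; ring.
      * apply Cpow_series_abs_summable with (zeta 2); auto using unit_disc_opp, unit_disc_pow.
        intros; apply zeta_coef_bounded; lia.
    + intros n; unfold zeta_coef.
      rewrite RtoC_div, Cpow_add_r by (apply not_0_INR; lia).
      unfold Cdiv; rewrite Cpow_1_r; ring.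
Qed.

Lemma ell_quotient_0 (r : nat) : (1 <= r)%nat -> ell_quotient r 0 <> 0.
Proof.
  intros Hr; destruct r as [|[|r]]; [lia| |]; unfold ell_quotient.
  - pose proof euler_gamma_pos.
    rewrite Cmult_0_l, Copp_0, Cplus_0_r; intros E; apply RtoC_inj in E; lra.
  - replace (- 0 ^ S (S r)) with (RtoC 0) by (simpl; ring).
    rewrite Cpow_series_0 with (M := zeta 2).
    + pose proof (zeta_bounds ((0 + 1) * S (S r)) ltac:(lia)).
      intros E; apply RtoC_inj in E; unfold zeta_coef in E; simpl INR in E; lra.
    + intros; apply zeta_coef_bounded; lia.
Qed.

Lemma ex_Cderive_ell_quotient (r : nat) (z : C) :
  (1 <= r)%nat -> unit_disc z -> ex_Cderive (ell_quotient r) z.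
Proof.
  intros Hr Hz; destruct r as [|[|r]]; [lia| |]; unfold ell_quotient.
  - apply (ex_derive_plus (K := C_AbsRing) (V := C_self)).
    { exact (ex_derive_const (K := C_AbsRing) (V := C_self) (RtoC euler_gamma) z). }
    apply ex_Cderive_opp, ex_Cderive_mult; [apply (ex_derive_id (K := C_AbsRing))|].
    apply ex_Cderive_comp.
    + apply ex_Cderive_Cpow_series with (zeta 2); auto using unit_disc_opp.
      intros; apply zeta_coef_bounded; lia.
    + apply ex_Cderive_opp, (ex_derive_id (K := C_AbsRing)).
  - apply (ex_Cderive_comp _ (fun z => - z ^ S (S r))).
    + apply ex_Cderive_Cpow_series with (zeta 2).
      * intros; apply zeta_coef_bounded; lia.
      * apply unit_disc_opp, unit_disc_pow; auto.
    + apply ex_Cderive_opp, ex_Cderive_pow.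
Qed.

Lemma continuous_ell_quotient (r : pos_index) :
  continuous_C (ell_quotient (proj1_sig r)) (RtoC 0).
Proof.
  apply (ex_derive_continuous (K := C_AbsRing) (V := C_self)).
  apply ex_Cderive_ell_quotient; [exact (proj2_sig r) | exact unit_disc_0].
Qed.

Lemma ex_Cderive_ell (r : pos_index) (z : C) : unit_disc z -> ex_Cderive (ell r) z.
Proof.
  intros Hz.
  apply (ex_derive_ext_loc (K := C_AbsRing) (V := C_self)
    (fun z => z ^ proj1_sig r * ell_quotient (proj1_sig r) z)).
  - assert (Hd : (0 < 1 - Cmod z)%R) by (unfold unit_disc in Hz; lra).
    exists (mkposreal _ Hd); intros w Hw.
    change (Cmod (w - z) < 1 - Cmod z)%R in Hw.
    symmetry; apply ell_factor; unfold unit_disc.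
    replace w with (z + (w - z)) by ring.
    eapply Rle_lt_trans; [apply Cmod_triangle | lra].
  - apply ex_Cderive_mult; [apply ex_Cderive_pow|].
    apply ex_Cderive_ell_quotient; [exact (proj2_sig r) | exact Hz].
Qed.

Theorem proposition2p12 :
  (forall r : pos_index,
     holomorphic_on unit_disc (ell r) /\ holomorphic_on unit_disc (exp_ell r)) /\
  linearly_free_on unit_disc (option pos_index) (adjoin_one pos_index ell) /\
  linearly_free_on unit_disc (option pos_index) (adjoin_one pos_index exp_ell).
Proof.
  repeat split.
  - intros z Hz; apply ex_derive_of_ex_Cderive, ex_Cderive_ell, Hz.
  - intros z Hz; apply ex_derive_of_ex_Cderive.
    apply (ex_Cderive_comp Cexp (ell r)); [|now apply ex_Cderive_ell].
    eexists; apply is_derive_Cexp.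
  - apply free_of_distinct_orders
      with (b := fun _ => RtoC 0) (h := fun r => ell_quotient (proj1_sig r)).
    + intros r z Hz; rewrite ell_factor by exact Hz; ring.
    + exact continuous_ell_quotient.
    + intros r; apply ell_quotient_0, (proj2_sig r).
  - set (h := fun (r : pos_index) => ell_quotient (proj1_sig r)).
    set (w := fun (r : pos_index) z => z ^ proj1_sig r * h r z).
    assert (Hw : forall r, w r 0 = 0).
    { intros [[|r] Hr]; [lia|]; unfold w; simpl; ring. }
    apply free_of_distinct_orders
      with (b := fun _ => RtoC 1) (h := fun r z => h r z * Cexp_quotient (w r z)).
    + intros r z Hz; unfold exp_ell.
      rewrite Cexp_factor, ell_factor by exact Hz; unfold w, h; ring.
    + intros r; apply continuous_C_mult.
      { apply continuous_ell_quotient. }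
      apply continuous_C_comp; [rewrite Hw; exact continuous_Cexp_quotient|].
      apply continuous_C_mult; [apply continuous_C_pow | apply continuous_ell_quotient].
    + intros r; rewrite Hw, Cexp_quotient_0, Cmult_1_r.
      apply ell_quotient_0, (proj2_sig r).
Qed.
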